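(* Let $d,\delta,Len$ be positive integers, $z>0$ a real number with $z\le d\,\delta$, and $\beta\in[0,1)$. Put $\kappa_0=\lceil d/Len\rceil$, $$\nu=\left\lfloor\frac{d\,\delta-z}{Len\,(1-\beta)}\right\rfloor,\qquad \kappa_2=\left\lfloor\frac{\nu}{\delta}\right\rfloor,\qquad \kappa_3=\frac{\nu}{\delta}.$$ Write $si^i=\delta-o^i$ for the number of spot instances bid for at the $i$-th allocation. Then the following choices are optimal solutions of problem (P) defined in the context (i.e. expected optimal strategies for maximizing the total workload processed by spot instances): 1. If $(\kappa_0-1)\,\delta\le\nu$: $\kappa_1=\kappa_0$ and $si^1=\dots=si^{\kappa_1}=\delta$. 2. If $\nu<(\kappa_0-1)\,\delta$ and $\kappa_2=\kappa_3$: $\kappa_1=\kappa_2+1$ and $si^1=\dots=si^{\kappa_1}=\delta$. 3. If $\nu<(\kappa_0-1)\,\delta$ and $\kappa_2<\kappa_3$: $\kappa_1=\kappa_2+2$, $si^i=\delta$ for all $i\in\{1,\dots,\kappa_1-2\}\cup\{\kappa_1\}$, and $si^{\kappa_1-1}=\nu-\kappa_2\,\delta$.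
   Context: Setting: a job with workload $z$, parallelism bound $\delta$ and relative deadline $d$ (in slots) is to be processed by on-demand and spot instances. An hour has $Len$ slots and allocations are updated hourly; at the $i$-th update $o^i$ on-demand instances are acquired and $\delta-o^i$ spot instances are bid for. The expected time for which the spot instances can be used in an hour is $\beta\,Len$ slots. $\kappa_1$ is the number of allocation updates at which the job has flexibility to use spot instances. Problem (P): the variables are an integer $\kappa_1\ge 1$ and integers $o^1,\dots,o^{\kappa_1}\in[0,\delta]$. Maximize $$\sum_{i=1}^{\kappa_1}(\delta-o^i)\cdot Len\cdot\beta$$ subject to (a) $\kappa_1\le\kappa_0$; (b) $\displaystyle\sum_{i=1}^{\kappa_1-1}(\delta-o^i)\,Len\,(1-\beta)\le d\,\delta-z$; (c) $\displaystyle\sum_{i=1}^{\kappa_1}(\delta-o^i)\,Len\,(1-\beta)> d\,\delta-z$, where this constraint (expressing that there is no flexibility at the $(\kappa_1+1)$-th update) is regarded as automatically satisfied when $\kappa_1=\kappa_0$, since then no time remains after the $\kappa_1$-th hour. An optimal solution is a feasible point whose objective value is maximal among all feasible points. *)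

(* Defs.v *)
From HB Require Import structures.
From mathcomp Require Import all_boot all_order all_algebra.
From mathcomp Require Import reals.
Set Implicit Arguments.
Unset Strict Implicit.
Unset Printing Implicit Defensive.
Import Order.TTheory GRing.Theory Num.Theory.
Local Open Scope ring_scope.

Definition kappa0 (R : realType) (d Len : nat) : int :=
  Num.ceil (d%:R / Len%:R : R).

Definition nu (R : realType) (d delta Len : nat) (z beta : R) : int :=
  Num.floor (((d * delta)%:R - z) / (Len%:R * (1 - beta))).

Definition kappa3 (R : realType) (d delta Len : nat) (z beta : R) : R :=
  (nu d delta Len z beta)%:~R / delta%:R.

Definition kappa2 (R : realType) (d delta Len : nat) (z beta : R) : int :=
  Num.floor (kappa3 d delta Len z beta).

(* A candidate solution is a pair (k1, o): k1 is the number of allocation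
   updates and o i is the number of on-demand instances acquired at the i-th
   update, i = 1, ..., k1.  The values of o outside this range are never used;
   in the sums below, `|k1| is just k1 seen as a natural number (k1 >= 1). *)
Definition si (delta : nat) (o : int -> int) (i : int) : int :=
  delta%:Z - o i.

Definition objective (R : realType) (delta Len : nat) (beta : R)
    (k1 : int) (o : int -> int) : R :=
  \sum_(1 <= i < `|k1|%N.+1) (si delta o i%:Z)%:~R * Len%:R * beta.

(* In the last clause, the lack of flexibility at update k1 + 1 is automatic
   when k1 = kappa0, as no time remains after the k1-th hour. *)
Definition feasible (R : realType) (d delta Len : nat) (z beta : R)
    (k1 : int) (o : int -> int) : Prop :=
  [/\ 1 <= k1,
      forall i : int, 1 <= i <= k1 -> 0 <= o i <= delta%:Z,
      k1 <= kappa0 R d Len,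
      \sum_(1 <= i < `|k1|%N) (si delta o i%:Z)%:~R * Len%:R * (1 - beta)
        <= (d * delta)%:R - z
    & k1 = kappa0 R d Len \/
      (d * delta)%:R - z <
        \sum_(1 <= i < `|k1|%N.+1)
          (si delta o i%:Z)%:~R * Len%:R * (1 - beta)].

Definition optimal (R : realType) (d delta Len : nat) (z beta : R)
    (k1 : int) (o : int -> int) : Prop :=
  feasible d delta Len z beta k1 o /\
  forall (k1' : int) (o' : int -> int),
    feasible d delta Len z beta k1' o' ->
    objective delta Len beta k1' o' <= objective delta Len beta k1 o.

(* Main.v *)
(* Summing the capacity constraints, everything depends only on the integers
   S(k) = si^1 + ... + si^k: (b) reads S(k1 - 1) <= nu, (c) reads nu < S(k1),
   and the objective is S(k1) * Len * beta.  Since each si^i is at most delta,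
   every feasible point has S(k1) <= kappa0 * delta and S(k1) <= nu + delta;
   the first bound is attained in case 1 and the second one in cases 2 and 3. *)
Require Import Defs.
From HB Require Import structures.
From mathcomp Require Import all_boot all_order all_algebra.
From mathcomp Require Import reals.
From mathcomp Require Import zify.
Set Implicit Arguments.
Unset Strict Implicit.
Unset Printing Implicit Defensive.
Import Order.TTheory GRing.Theory Num.Theory.
Local Open Scope ring_scope.

(** The index is a natural number, so that bounds on partial sums go by induction; an update count
    [k1 >= 1] is written [k.+1] from here on. *)
Definition spots (delta : nat) (o : int -> int) (k : nat) : int :=
  \sum_(1 <= i < k.+1) si delta o i%:Z.

Lemma spots0 delta o : spots delta o 0 = 0.
Proof. by rewrite /spots big_geq. Qed.

Lemma spotsS delta o k :
  spots delta o k.+1 = spots delta o k + si delta o k.+1%:Z.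
Proof. by rewrite /spots big_nat_recr. Qed.

Lemma spots_full delta o k :
  (forall i : int, 1 <= i <= k%:Z -> si delta o i = delta%:Z) ->
  spots delta o k = k%:Z * delta%:Z.
Proof.
elim: k => [|k IHk] full; first by rewrite spots0 mul0r.
rewrite spotsS IHk => [|i ile]; last by apply: full; lia.
by rewrite full; lia.
Qed.

Lemma spots_le delta o k :
  (forall i : int, 1 <= i <= k%:Z -> 0 <= o i <= delta%:Z) ->
  spots delta o k <= k%:Z * delta%:Z.
Proof.
elim: k => [|k IHk] ob; first by rewrite spots0 mul0r.
have := ob k.+1%:Z; have : spots delta o k <= k%:Z * delta%:Z.
  by apply: IHk => i ile; apply: ob; lia.
by rewrite spotsS /si; lia.
Qed.

Section Problem.
Variables (R : realType) (d delta Len : nat) (z beta : R).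
Hypotheses (d_gt0 : (0 < d)%N) (delta_gt0 : (0 < delta)%N).
Hypotheses (Len_gt0 : (0 < Len)%N) (z_le : z <= (d * delta)%:R).
Hypotheses (beta_ge0 : 0 <= beta) (beta_lt1 : beta < 1).

Local Notation k0 := (kappa0 R d Len).
Local Notation n := (nu d delta Len z beta).
Local Notation k2 := (kappa2 d delta Len z beta).
Local Notation k3 := (kappa3 d delta Len z beta).

Lemma sum_spots o k (c : R) :
  \sum_(1 <= i < k.+1) (si delta o i%:Z)%:~R * Len%:R * c
  = (spots delta o k)%:~R * (Len%:R * c).
Proof.
rewrite /spots rmorph_sum /= mulr_suml.
by apply: eq_bigr => i _; rewrite mulrA.
Qed.

Lemma slot_weight_gt0 : 0 < Len%:R * (1 - beta).
Proof. by rewrite mulr_gt0 ?ltr0n ?subr_gt0. Qed.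

(** Dividing by the positive weight [Len * (1 - beta)] leaves an integer below a real number, which
    is the same as lying below its floor. No precision is lost in passing from the real constraints
    to integer ones. *)
Lemma le_nuE (s : int) :
  (s%:~R * (Len%:R * (1 - beta)) <= (d * delta)%:R - z) = (s <= n).
Proof. by rewrite -ler_pdivlMr ?slot_weight_gt0// floor_ge_int. Qed.

Lemma lt_nuE (s : int) :
  ((d * delta)%:R - z < s%:~R * (Len%:R * (1 - beta))) = (n < s).
Proof. by rewrite !ltNge le_nuE. Qed.

Lemma nu_ge0 : 0 <= n.
Proof. by rewrite -le_nuE mul0r subr_ge0. Qed.

Lemma kappa0_ge1 : 1 <= k0.
Proof. by rewrite -gtz0_ge1 ceil_gt0 divr_gt0 ?ltr0n. Qed.

Lemma feasibleE k o :
  feasible d delta Len z beta k.+1%:Z o <->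
  [/\ forall i : int, 1 <= i <= k.+1%:Z -> 0 <= o i <= delta%:Z,
      k.+1%:Z <= k0,
      spots delta o k <= n
    & k.+1%:Z = k0 \/ n < spots delta o k.+1].
Proof.
rewrite /feasible absz_nat !sum_spots le_nuE lt_nuE.
by split=> [[]|[]].
Qed.

Lemma feasible_spots_le k o :
  feasible d delta Len z beta k.+1%:Z o ->
  spots delta o k.+1 <= k0 * delta%:Z /\ spots delta o k.+1 <= n + delta%:Z.
Proof.
case/feasibleE => ob kle sle _; split.
  apply: le_trans (spots_le ob) _.
  by rewrite ler_wpM2r.
by rewrite spotsS lerD// gerBl; case/andP: (ob k.+1%:Z (lexx k.+1%:Z)).
Qed.

Lemma optimal_spots k o :
  feasible d delta Len z beta k.+1%:Z o ->
  k0 * delta%:Z <= spots delta o k.+1 \/ n + delta%:Z <= spots delta o k.+1 ->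
  optimal d delta Len z beta k.+1%:Z o.
Proof.
move=> feas sge; split=> // k' o' feas'.
(* Zero and negative update counts violate [1 <= k1]. *)
case: k' feas' => [[|k']|k'] feas'; try by case: feas'.
have [s1 s2] := feasible_spots_le feas'.
rewrite /objective !absz_nat !sum_spots ler_wpM2r ?mulr_ge0 ?ler0n//.
by rewrite ler_int; case: sge => [|]; apply: le_trans.
Qed.

(** With [nu_lt_kappa2], this makes [k2] the quotient in the Euclidean division of [n] by [delta];
    the remainder is the one partial bid of case 3. *)
Lemma kappa2_le : k2 * delta%:Z <= n.
Proof.
have := floor_le k3.
rewrite /kappa3 ler_pdivlMr ?ltr0n//.
by rewrite -[delta%:R]/(delta%:Z%:~R) -intrM ler_int.
Qed.

Lemma kappa2_ge0 : 0 <= k2.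
Proof. by rewrite floor_ge0 divr_ge0 ?ler0n// ler0z nu_ge0. Qed.

Lemma nu_lt_kappa2 : n < (k2 + 1) * delta%:Z.
Proof.
have := floorD1_gt k3.
rewrite /kappa3 ltr_pdivrMr ?ltr0n//.
by rewrite -[delta%:R]/(delta%:Z%:~R) -intrM ltr_int.
Qed.

Lemma nu_eq_kappa2 : k2%:~R = k3 -> n = k2 * delta%:Z.
Proof.
move=> k2E; apply: (@intr_inj R); rewrite intrM k2E /kappa3 divfK//.
by rewrite pnatr_eq0 -lt0n.
Qed.

End Problem.

Theorem proposition4p6 (R : realType) (d delta Len : nat) (z beta : R)
    (d_gt0 : (0 < d)%N) (delta_gt0 : (0 < delta)%N) (Len_gt0 : (0 < Len)%N)
    (z_gt0 : 0 < z) (z_le : z <= (d * delta)%:R)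
    (beta_ge0 : 0 <= beta) (beta_lt1 : beta < 1) :
  let k0 := kappa0 R d Len in
  let n := nu d delta Len z beta in
  let k2 := kappa2 d delta Len z beta in
  let k3 := kappa3 d delta Len z beta in
  [/\ (k0 - 1) * delta%:Z <= n ->
      forall (k1 : int) (o : int -> int),
        k1 = k0 ->
        (forall i : int, 1 <= i <= k1 -> si delta o i = delta%:Z) ->
        optimal d delta Len z beta k1 o,
      n < (k0 - 1) * delta%:Z -> k2%:~R = k3 ->
      forall (k1 : int) (o : int -> int),
        k1 = k2 + 1 ->
        (forall i : int, 1 <= i <= k1 -> si delta o i = delta%:Z) ->
        optimal d delta Len z beta k1 o
    & n < (k0 - 1) * delta%:Z -> k2%:~R < k3 ->
      forall (k1 : int) (o : int -> int),
        k1 = k2 + 2 ->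
        (forall i : int, 1 <= i <= k1 - 2 \/ i = k1 ->
           si delta o i = delta%:Z) ->
        si delta o (k1 - 1) = n - k2 * delta%:Z ->
        optimal d delta Len z beta k1 o].
Proof.
move=> k0 n k2 k3.
have k0_ge1 : 1 <= k0 := kappa0_ge1 R d_gt0 Len_gt0.
have k2_ge0 : 0 <= k2 := kappa2_ge0 Len_gt0 z_le beta_lt1.
have k2_le : k2 * delta%:Z <= n := kappa2_le d Len z beta delta_gt0.
have n_lt : n < (k2 + 1) * delta%:Z := nu_lt_kappa2 d Len z beta delta_gt0.
split.
- move=> n_ge k1 o k1E full.
  have [k kE] : exists k : nat, k1 = k.+1%:Z by exists `|k1|.-1%N; lia.
  subst k1; rewrite kE in full *.
  have sE : spots delta o k.+1 = k.+1%:Z * delta%:Z by apply: spots_full.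
  apply: optimal_spots => //; last by left; rewrite sE -kE.
  apply/feasibleE => //; rewrite -/k0 -/n kE; split=> //; last by left.
    by move=> i ile; have := full i ile; rewrite /si; lia.
  (* Constraint (b) involves only the first [k0 - 1] updates, whose full bids total
     [(k0 - 1) * delta]. *)
  rewrite spots_full => [|i ile]; last by apply: full; lia.
  by move: n_ge; rewrite kE; apply: le_trans; rewrite ler_wpM2r//; lia.
- move=> n_k0 k2E k1 o -> {k1} full.
  have nE : n = k2 * delta%:Z := nu_eq_kappa2 delta_gt0 k2E.
  have k2_lt : k2 < k0 - 1 by rewrite -(@ltr_pM2r _ delta%:Z) -?nE.
  have [k kE] : exists k : nat, k2 = k%:Z by exists `|k2|%N; lia.
  have k1E : k2 + 1 = k.+1%:Z by lia.
  rewrite k1E in full *.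
  have sE : spots delta o k = n.
    by rewrite nE kE; apply: spots_full => i ile; apply: full; lia.
  have sSE : spots delta o k.+1 = n + delta%:Z.
    by rewrite spotsS sE full//; lia.
  apply: optimal_spots => //; last by right; rewrite sSE.
  apply/feasibleE => //; rewrite -/k0 -/n sE sSE; split=> //.
  + by move=> i ile; have := full i ile; rewrite /si; lia.
  + by lia.
  + by right; lia.
- move=> n_k0 _ k1 o -> {k1} full.
  (* For integers this says [k2 + 2 <= k0], which is constraint (a) here. *)
  have k2_lt : k2 < k0 - 1.
    by rewrite -(@ltr_pM2r _ delta%:Z)//; apply: le_lt_trans n_k0.
  have [k kE] : exists k : nat, k2 = k%:Z by exists `|k2|%N; lia.
  have -> : k2 + 2 - 1 = k.+1%:Z by lia.
  have k1E : k2 + 2 = k.+2%:Z by lia.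
  rewrite k1E in full * => siE.
  (* The [k2] full bids followed by the remainder exhaust [n] exactly, so the last full bid reaches
     the bound [n + delta]. *)
  have sE : spots delta o k.+1 = n.
    rewrite spotsS siE spots_full => [|i ile]; first by rewrite kE; lia.
    by apply: full; left; lia.
  have sSE : spots delta o k.+2 = n + delta%:Z.
    by rewrite spotsS sE full//; right.
  apply: optimal_spots => //; last by right; rewrite sSE.
  apply/feasibleE => //; rewrite -/k0 -/n sE sSE; split=> //.
  (* The partial bid lies in [[0, delta)] as a Euclidean remainder; expanding [(k2 + 1) * delta]
     makes this linear in the product [k2 * delta]. All other bids are full. *)
  + move=> i ile; case: (eqVneq i k.+1%:Z) => [->|i_neq].
      by move: siE n_lt k2_le; rewrite mulrDl mul1r /si; lia.
    have : si delta o i = delta%:Z by apply: full; lia.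
    by rewrite /si; lia.
  + by lia.
  + by right; lia.
Qed.
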